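(* Let $n\ge 4$, and let $\mathcal L_1,\mathcal L_2$ be the complex Leibniz algebras with basis $\{h_1,h_2,e_1,\dots,e_n\}$ where $\mathcal L_1$ has nonzero products $[e_1,e_1]=e_3$, $[e_i,e_1]=e_{i+1}$ ($3\le i\le n-1$), $[e_1,h_2]=e_1$, $[h_2,e_1]=-e_1$, $[e_2,h_1]=e_2$, $[h_1,e_2]=-e_2$, $[e_i,h_2]=(i-1)e_i$ ($3\le i\le n$), and $\mathcal L_2$ has the same products except $[h_1,e_2]=0$. Put $e_{n+1}=0$. (1) $(d,D)$ is a biderivation of $\mathcal L_1$ iff there are $\alpha_1,\dots,\alpha_4,\beta_4,\dots,\beta_{n+1}\in\mathbb C$ with $d(h_1)=-\alpha_2e_2$, $d(h_2)=-\alpha_1e_1$, $d(e_1)=\alpha_4e_1+\alpha_1e_3$, $d(e_2)=\alpha_3e_2$, $d(e_i)=(i-1)\alpha_4e_i+\alpha_1e_{i+1}$ ($3\le i\le n$), and $D(h_1)=-\alpha_2e_2$, $D(h_2)=-\alpha_1e_1+\sum_{i=3}^{n-1}(i-1)\beta_{i+1}e_i+\beta_{n+1}e_n$, $D(e_1)=\alpha_4e_1-\alpha_1e_3+\sum_{i=4}^n\beta_ie_i$, $D(e_2)=\alpha_3e_2$, $D(e_i)=0$ ($3\le i\le n$). (2) $(d,D)$ is a biderivation of $\mathcal L_2$ iff there are $\alpha_1,\alpha_2,\alpha_3,\beta_4,\dots,\beta_{n+2}\in\mathbb C$ with $d(h_1)=0$, $d(h_2)=-\alpha_1e_1$, $d(e_1)=\alpha_3e_1+\alpha_1e_3$,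 $d(e_2)=\alpha_2e_2$, $d(e_i)=(i-1)\alpha_3e_i+\alpha_1e_{i+1}$ ($3\le i\le n$), and $D(h_1)=\beta_{n+2}e_2$, $D(h_2)=-\alpha_1e_1+\sum_{i=3}^{n-1}(i-1)\beta_{i+1}e_i+\beta_{n+1}e_n$, $D(e_1)=\alpha_3e_1-\alpha_1e_3+\sum_{i=4}^n\beta_ie_i$, $D(e_i)=0$ ($2\le i\le n$).
   Context: Leibniz algebras are right Leibniz over $\mathbb C$: $[x,[y,z]]=[[x,y],z]-[[x,z],y]$. Unlisted products are zero. A derivation is a linear $d$ with $d([x,y])=[d(x),y]+[x,d(y)]$; an anti-derivation is a linear $D$ with $D([x,y])=[D(x),y]-[D(y),x]$; a biderivation is a pair $(d,D)$ of a derivation and an anti-derivation with $[x,d(y)]=[x,D(y)]$ for all $x,y$. *)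

(* Defs.v *)
From mathcomp Require Import all_boot all_order all_algebra.
From mathcomp Require Import complex Rstruct.
Unset Printing Implicit Defensive.
Import GRing.Theory.
Local Open Scope ring_scope.

Definition Cx : fieldType := (Rdefinitions.R)[i].

(* The underlying vector space of dimension n+2, as row vectors.
   Coordinate index 0 <-> h1, 1 <-> h2, j+1 <-> e_j (1 <= j <= n). *)
Definition Lsp (n : nat) := 'rV[Cx]_(n.+2).

Definition bas (n k : nat) : Lsp n :=
  if (k < n.+2)%N then delta_mx 0 (inord k) else 0.
Definition crd (n k : nat) (x : Lsp n) : Cx := x 0 (inord k).

Definition h1 n : Lsp n := bas n 0.
Definition h2 n : Lsp n := bas n 1.
Definition e n (j : nat) : Lsp n := if (1 <= j <= n)%N then bas n j.+1 else 0.

Definition ch1 n (x : Lsp n) := crd n 0 x.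
Definition ch2 n (x : Lsp n) := crd n 1 x.
Definition ce n (j : nat) (x : Lsp n) := crd n j.+1 x.

(* Bilinear extension of the multiplication table.
   two = false : L_1 ;  two = true : L_2 (same table but [h1,e2] = 0). *)
Definition brk (two : bool) (n : nat) (x y : Lsp n) : Lsp n :=
    (ce n 1 x * ce n 1 y) *: e n 3
  + \sum_(3 <= i < n) (ce n i x * ce n 1 y) *: e n i.+1
  + (ce n 1 x * ch2 n y) *: e n 1
  - (ch2 n x * ce n 1 y) *: e n 1
  + (ce n 2 x * ch1 n y) *: e n 2
  - (if two then 0 else ch1 n x * ce n 2 y) *: e n 2
  + \sum_(3 <= i < n.+1) ((i.-1)%:R * ce n i x * ch2 n y) *: e n i.

Definition L1br n := brk false n.
Definition L2br n := brk true n.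

Definition is_derivation {V : lmodType Cx} (br : V -> V -> V) (d : {linear V -> V}) :=
  forall x y, d (br x y) = br (d x) y + br x (d y).
Definition is_antiderivation {V : lmodType Cx} (br : V -> V -> V) (D : {linear V -> V}) :=
  forall x y, D (br x y) = br (D x) y - br (D y) x.
Definition is_biderivation {V : lmodType Cx} (br : V -> V -> V) (d D : {linear V -> V}) :=
  [/\ is_derivation br d, is_antiderivation br D & forall x y, br x (d y) = br x (D y)].

(* Main.v *)
Require Import Defs.
From mathcomp Require Import all_boot all_order all_algebra.
From mathcomp Require Import complex Rstruct.
From mathcomp Require Import ring.
Import GRing.Theory Num.Theory.
Local Open Scope ring_scope.

(* Comparing coordinates in d[x,y] and D[x,y] for a few pairs of basis vectors
   determines a derivation d on h1, h2, e_1, e_2, and on e_i (i >= 3) by the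
   recursion e_{i+1} = [e_i,e_1].  The condition [x,d(y)] = [x,D(y)] says that
   d - D maps into the right annihilator, which is spanned by e_3, ..., e_n for
   L_1 and by e_2, ..., e_n for L_2; so D agrees with d on all coordinates but
   these, and the products with h_2 and e_1 determine the rest. Both algebras
   are treated at once: they differ only in the relations between the four
   constants attached to e_2. *)

(** * Scalars: nonzero integers and linear equations in one unknown *)

Lemma Cx_natr_neq0 k : (k.+1%:R : Cx) != 0.
Proof. by have := pnatr_eq0 (Rdefinitions.R)[i] k.+1 => /= ->. Qed.

(* Unification would otherwise compare ring terms by unfolding them to pairs of reals. *)
Opaque Cx.

(** Elimination step for a linear equation [a = b]: [c] is the pivot, and the last hypothesis is a
    polynomial identity that [ring] can check. *)
Lemma eq_of_scaled {F : fieldType} (c : F) {a b : F} (x y : F) :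
  a = b -> c != 0 -> c * (x - y) = a - b -> x = y.
Proof.
move=> -> c0 /eqP; rewrite subrr mulf_eq0 (negPf c0) subr_eq0 /=.
by move/eqP.
Qed.

(** * Coordinates of vectors and of sums over the [e n i] *)

Section Coordinates.
Context {n : nat}.
Implicit Types x y : Lsp n.

Lemma crdD k x y : crd n k (x + y) = crd n k x + crd n k y.
Proof. by rewrite /crd mxE. Qed.

Lemma crdN k x : crd n k (- x) = - crd n k x.
Proof. by rewrite /crd mxE. Qed.

Lemma crdZ k a x : crd n k (a *: x) = a * crd n k x.
Proof. by rewrite /crd mxE. Qed.

Lemma crd0 k : crd n k (0 : Lsp n) = 0.
Proof. by rewrite /crd mxE. Qed.

Definition crd_lin := (crdD, crdN, crdZ, crd0).

Lemma crd_bas k i : (k < n.+2)%N -> crd n k (bas n i) = (k == i)%:R.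
Proof.
move=> hk; rewrite /bas; case: ltnP => hi.
  by rewrite /crd mxE eqxx /= -val_eqE /= !inordK.
by rewrite crd0; case: eqP => // ki; move: hk; rewrite ki ltnNge hi.
Qed.

Lemma crd_h1 k : (k < n.+2)%N -> crd n k (h1 n) = (k == 0)%:R.
Proof. exact: crd_bas. Qed.

Lemma crd_h2 k : (k < n.+2)%N -> crd n k (h2 n) = (k == 1)%:R.
Proof. exact: crd_bas. Qed.

Lemma crd_e k i :
  (k < n.+2)%N -> crd n k (e n i) = ((0 < i)%N && (k == i.+1))%:R.
Proof.
move=> hk; rewrite /e; case: (posnP i) => [->|i0] /=; first by rewrite crd0.
case: leqP => hi; first by rewrite crd_bas.
by rewrite crd0; case: eqP => // ki; move: hk; rewrite ki !ltnS leqNgt hi.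
Qed.

Lemma crd_sum_e k p q (F : nat -> Cx) : (k < n.+1)%N -> (0 < p)%N ->
  crd n k.+1 (\sum_(p <= i < q) F i *: e n i)
  = if (p <= k < q)%N then F k else 0.
Proof.
move=> hk p0.
have -> : crd n k.+1 (\sum_(p <= i < q) F i *: e n i) =
          \sum_(p <= i < q) if i == k then F i else 0.
  rewrite /crd summxE; apply: eq_big_nat => i /andP[pi _].
  rewrite -/(crd n k.+1 (F i *: e n i)) crdZ crd_e // eqSS (leq_trans p0 pi).
  by rewrite eq_sym; case: eqP => _; rewrite ?mulr1 ?mulr0.
case: ifPn => h; last first.
  rewrite big_nat big1 // => i hi.
  by case: eqP => // ik; move: h; rewrite -ik hi.
rewrite (bigD1_seq k) ?iota_uniq ?mem_index_iota //= eqxx big1 ?addr0 //.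
by move=> i /negPf ->.
Qed.

Lemma crd0_sum_e p q (F : nat -> Cx) (g : nat -> nat) :
  crd n 0 (\sum_(p <= i < q) F i *: e n (g i)) = 0.
Proof.
rewrite /crd summxE big1 // => i _.
by rewrite -/(crd n 0 _) crdZ crd_e // andbF mulr0.
Qed.

Lemma crd_sum_eS k p q (F : nat -> Cx) : (k < n.+1)%N ->
  crd n k.+1 (\sum_(p <= i < q) F i *: e n i.+1)
  = if (p < k <= q)%N then F k.-1 else 0.
Proof.
move=> hk.
have -> : \sum_(p <= i < q) F i *: e n i.+1
          = \sum_(p.+1 <= i < q.+1) F i.-1 *: e n i by rewrite big_add1.
by rewrite crd_sum_e // ltnS.
Qed.

(** The coordinates of $h_1,h_2,e_1,e_2,e_3$ each follow a rule of their own; from $e_4$ on one rule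
    serves all, and [j.+4.+1] is the index of $e_{j+4}$. *)
Lemma vec_ext x y : (3 <= n)%N ->
    crd n 0 x = crd n 0 y -> crd n 1 x = crd n 1 y -> crd n 2 x = crd n 2 y ->
    crd n 3 x = crd n 3 y -> crd n 4 x = crd n 4 y ->
    (forall j, (j.+3 < n)%N -> crd n j.+4.+1 x = crd n j.+4.+1 y) ->
  x = y.
Proof.
move=> hn E0 E1 E2 E3 E4 E5; apply/rowP => -[k hk].
have: crd n k x = crd n k y by move: k hk => [|[|[|[|[|j]]]]] // hk; apply: E5.
by rewrite /crd (_ : inord k = Ordinal hk) //; apply: val_inj; rewrite /= inordK.
Qed.

End Coordinates.

(** * The bracket in coordinates *)

Section Bracket.
Context {two : bool} {n : nat} (hn : (3 <= n)%N).
Implicit Types x y : Lsp n.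

Let lek : ((0 < n)%N * (1 < n)%N * (2 < n)%N)%type.
Proof. by split; first split; rewrite // ltnW // ltnW. Qed.

Let basE := (@crd_lin n, @crd_h1 n, @crd_h2 n, @crd_e n).
Let sumE := (@crd0_sum_e n, @crd_sum_e n, @crd_sum_eS n).

Ltac simp_brk := rewrite /brk !(basE, sumE) ?ltnS ?lek //= /ce /ch1 /ch2.

Lemma crd_brk0 x y : crd n 0 (brk two n x y) = 0.
Proof. by simp_brk; ring. Qed.

Lemma crd_brk1 x y : crd n 1 (brk two n x y) = 0.
Proof. by simp_brk; ring. Qed.

Lemma crd_brk2 x y :
  crd n 2 (brk two n x y) = crd n 2 x * crd n 1 y - crd n 1 x * crd n 2 y.
Proof. by simp_brk; ring. Qed.

Lemma crd_brk3 x y :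
  crd n 3 (brk two n x y)
  = crd n 3 x * crd n 0 y - (if two then 0 else crd n 0 x * crd n 3 y).
Proof. by simp_brk; ring. Qed.

Lemma crd_brk4 x y :
  crd n 4 (brk two n x y)
  = crd n 2 x * crd n 2 y + 2%:R * crd n 4 x * crd n 1 y.
Proof. by simp_brk; ring. Qed.

Lemma crd_brk5 j x y : (j.+3 < n)%N ->
  crd n j.+4.+1 (brk two n x y)
  = crd n j.+4 x * crd n 2 y + j.+3%:R * crd n j.+4.+1 x * crd n 1 y.
Proof. by move=> hj; simp_brk; rewrite hj; ring. Qed.

Let brkE := (crd_brk0, crd_brk1, crd_brk2, crd_brk3, crd_brk4,
  crd_brk5).

Ltac crds := rewrite ?(brkE, basE) ?ltnS ?lek //=.
Ltac vext := apply: (vec_ext _ _ hn) => [|||||? /[dup] ? /ltnW ?]; crds;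
  try (try case: (two); crds; ring).

Lemma vec_decomp x :
  x = crd n 0 x *: h1 n + crd n 1 x *: h2 n + crd n 2 x *: e n 1
      + crd n 3 x *: e n 2 + \sum_(3 <= i < n.+1) crd n i.+1 x *: e n i.
Proof.
apply: (vec_ext _ _ hn) => [|||||j hj]; rewrite !(basE, sumE) ?ltnS ?lek //=;
  try ring.
by rewrite hj; ring.
Qed.

Lemma linear_decomp (f : {linear Lsp n -> Lsp n}) x :
  f x = crd n 0 x *: f (h1 n) + crd n 1 x *: f (h2 n) + crd n 2 x *: f (e n 1)
      + crd n 3 x *: f (e n 2) + \sum_(3 <= i < n.+1) crd n i.+1 x *: f (e n i).
Proof.
rewrite {1}(vec_decomp x) !linearD linear_sum !linearZ /=; congr (_ + _).
by apply: eq_bigr => i _; rewrite linearZ.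
Qed.

(** * Products of basis vectors *)

Lemma brk_h1h1 : brk two n (h1 n) (h1 n) = 0. Proof. by vext. Qed.
Lemma brk_h1h2 : brk two n (h1 n) (h2 n) = 0. Proof. by vext. Qed.
Lemma brk_h2h1 : brk two n (h2 n) (h1 n) = 0. Proof. by vext. Qed.
Lemma brk_h2h2 : brk two n (h2 n) (h2 n) = 0. Proof. by vext. Qed.
Lemma brk_e1h1 : brk two n (e n 1) (h1 n) = 0. Proof. by vext. Qed.
Lemma brk_e1h2 : brk two n (e n 1) (h2 n) = e n 1. Proof. by vext. Qed.
Lemma brk_e2h1 : brk two n (e n 2) (h1 n) = e n 2. Proof. by vext. Qed.
Lemma brk_e2h2 : brk two n (e n 2) (h2 n) = 0. Proof. by vext. Qed.
Lemma brk_e1e1 : brk two n (e n 1) (e n 1) = e n 3. Proof. by vext. Qed.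
Lemma brk_h1e2 : brk two n (h1 n) (e n 2) = if two then 0 else - e n 2.
Proof. by vext. Qed.
(** True for every [i], because [e n k] is 0 for [k > n]; this includes $[e_n,e_1]=0$. *)
Lemma brk_eie1 i : brk two n (e n i.+3) (e n 1) = e n i.+4.
Proof. by vext. Qed.

End Bracket.

(** * Derivations, anti-derivations and their compatibility *)

Section Biderivations.
Context {two : bool} {n : nat} (hn : (3 <= n)%N).
Implicit Types x y : Lsp n.

Let lek : ((0 < n)%N * (1 < n)%N * (2 < n)%N)%type.
Proof. by split; first split; rewrite // ltnW // ltnW. Qed.

Let basE := (@crd_lin n, @crd_h1 n, @crd_h2 n, @crd_e n).
Let sumE := (@crd0_sum_e n, @crd_sum_e n).
Let brkE := (@crd_brk0 two n, @crd_brk1 two n, @crd_brk2 two n hn,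
  @crd_brk3 two n hn, @crd_brk4 two n hn, @crd_brk5 two n).
Let prodE := (@brk_h1h1 two n hn, @brk_h1h2 two n hn, @brk_h2h1 two n hn,
  @brk_h2h2 two n hn, @brk_e1h1 two n hn, @brk_e1h2 two n hn,
  @brk_e2h1 two n hn, @brk_e2h2 two n hn, @brk_e1e1 two n hn,
  @brk_eie1 two n hn).

Let simp0 := (@mul0r Cx, @mulr0 Cx, @addr0 Cx, if_same).

Ltac close_bound := match goal with
  | |- is_true _ => rewrite ?ltnS ?lek //; exact: ltnW
  | |- _ => idtac
  end.

(** [der] evaluates a coordinate identity [E] on basis vectors; [solve_for] then isolates the
    unknown, [k] being its coefficient in the left side minus the right side of [E]. *)
Ltac der R E :=
  rewrite ?(R, basE) ?ltnS ?lek //= ?simp0 in E.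
Ltac solve_for E k :=
  apply: (eq_of_scaled k _ _ E); rewrite ?oppr_eq0 ?oner_eq0 ?Cx_natr_neq0 //;
  ring.

Definition der_formula (a1 a2 a3 a4 : Cx) (d : Lsp n -> Lsp n) : Prop :=
  [/\ d (h1 n) = - a2 *: e n 2,
      d (h2 n) = - a1 *: e n 1,
      d (e n 1) = a4 *: e n 1 + a1 *: e n 3,
      d (e n 2) = a3 *: e n 2 &
      (forall i, (3 <= i <= n)%N ->
         d (e n i) = ((i.-1)%:R * a4) *: e n i + a1 *: e n i.+1)].

(** The coefficients [c] and [f] along $e_2$ are left free, so that one formula serves both
    algebras. *)
Definition antider_formula (a1 a4 c f : Cx) (b : nat -> Cx)
    (D : Lsp n -> Lsp n) : Prop :=
  [/\ D (h1 n) = c *: e n 2,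
      D (h2 n) = - a1 *: e n 1
                 + \sum_(3 <= i < n) ((i.-1)%:R * b i.+1) *: e n i
                 + b n.+1 *: e n n,
      D (e n 1) = a4 *: e n 1 + - a1 *: e n 3
                  + \sum_(4 <= i < n.+1) b i *: e n i,
      D (e n 2) = f *: e n 2 &
      (forall i, (3 <= i <= n)%N -> D (e n i) = 0)].

(** Extending the formulas linearly from the basis to all vectors turns the biderivation identities
    into polynomial identities in coordinates. *)
Lemma crd_der_formula a1 a2 a3 a4 (d : {linear Lsp n -> Lsp n}) :
    der_formula a1 a2 a3 a4 d ->
  [/\ forall x, crd n 0 (d x) = 0, forall x, crd n 1 (d x) = 0 &
  [/\ forall x, crd n 2 (d x) = a4 * crd n 2 x - a1 * crd n 1 x,
      forall x, crd n 3 (d x) = a3 * crd n 3 x - a2 * crd n 0 x,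
      forall x, crd n 4 (d x) = 2%:R * a4 * crd n 4 x + a1 * crd n 2 x &
      forall x j, (j.+3 < n)%N ->
        crd n j.+4.+1 (d x) =
          j.+3%:R * a4 * crd n j.+4.+1 x + a1 * crd n j.+4 x]].
Proof.
move=> [d1 d2 d3 d4 d5].
pose F x i := crd n i.+1 x * (i.-1%:R * a4).
(* Collects the terms $\alpha_1e_{i+1}$ after a shift of index: [crd n i x] is the coordinate of $x$
   along $e_{i-1}$. The last term of the shifted sum contains $e_{n+1}=0$. *)
pose G x i := crd n i x * a1.
have E x : d x = crd n 0 x *: (- a2 *: e n 2) + crd n 1 x *: (- a1 *: e n 1)
    + crd n 2 x *: (a4 *: e n 1 + a1 *: e n 3) + crd n 3 x *: (a3 *: e n 2)
    + (\sum_(3 <= i < n.+1) F x i *: e n i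
       + \sum_(4 <= i < n.+2) G x i *: e n i).
  rewrite (linear_decomp hn) d1 d2 d3 d4; congr (_ + _).
  rewrite (big_add1 _ _ 3) -big_split /=; apply: eq_big_nat => i hi.
  by rewrite (d5 i hi) scalerDr !scalerA.
split; last split; move=> x; rewrite E; [..|move=> j /[dup] hj /ltnW hj'].
all: rewrite !(basE, sumE) ?ltnS ?lek //= ?hj ?hj' ?andbF /F /G /=; ring.
Qed.

(** The case distinctions ask whether the basis vector is the last one: along $e_n$ the image of
    $h_2$ has the separate coefficient [b n.+1]. *)
Lemma crd_antider_formula a1 a4 c f b (D : {linear Lsp n -> Lsp n}) :
    antider_formula a1 a4 c f b D ->
  [/\ forall x, crd n 0 (D x) = 0, forall x, crd n 1 (D x) = 0 &
  [/\ forall x, crd n 2 (D x) = a4 * crd n 2 x - a1 * crd n 1 x,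
      forall x, crd n 3 (D x) = f * crd n 3 x + c * crd n 0 x,
      forall x, crd n 4 (D x) =
        (if (3 < n)%N then 2%:R * b 4 else b n.+1) * crd n 1 x
        - a1 * crd n 2 x &
      forall x j, (j.+3 < n)%N ->
        crd n j.+4.+1 (D x) =
          (if (j.+4 < n)%N then j.+3%:R * b j.+4.+1 else b n.+1) * crd n 1 x
          + b j.+4 * crd n 2 x]].
Proof.
move=> [d1 d2 d3 d4 d5].
have E x : D x = crd n 0 x *: (c *: e n 2)
    + crd n 1 x *: (- a1 *: e n 1
                    + \sum_(3 <= i < n) ((i.-1)%:R * b i.+1) *: e n i
                    + b n.+1 *: e n n)
    + crd n 2 x *: (a4 *: e n 1 + - a1 *: e n 3
                    + \sum_(4 <= i < n.+1) b i *: e n i)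
    + crd n 3 x *: (f *: e n 2).
  rewrite (linear_decomp hn) d1 d2 d3 d4.
  rewrite -[RHS]addr0; congr (_ + _); rewrite big_nat big1 // => i hi.
  by rewrite (d5 i hi) scaler0.
have n0 : 0 == n = false by rewrite ltn_eqF ?lek.
have n1 : 1 == n = false by rewrite ltn_eqF ?lek.
have n2 : 2 == n = false by rewrite ltn_eqF ?lek.
split; last split; move=> x; rewrite E; [..|move=> j /[dup] hj /ltnW hj'];
  rewrite !(basE, sumE) ?ltnS ?lek //= ?hj ?hj' ?eqSS ?n0 ?n1 ?n2 ?andbF /=; try ring.
  by case: (ltngtP 3 n) => [_|h|_] /=; [ring | by move: h; rewrite ltnNge hn | ring].
by case: (ltngtP j.+4 n) => [_|h|_] /=; [ring | by move: h; rewrite ltnNge hj | ring].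
Qed.

(* Constraints on the coordinates -a2, c (of d(h1), D(h1)) and a3, f (of d(e_2), D(e_2)) along e_2. *)
Definition constants_match (a2 a3 c f : Cx) : Prop :=
  if two then a2 = 0 /\ f = 0 else c = - a2 /\ f = a3.

(** * The formulas define biderivations *)

Lemma biderivation_of_formulas a1 a2 a3 a4 c f b (d D : {linear Lsp n -> Lsp n}) :
    constants_match a2 a3 c f ->
    der_formula a1 a2 a3 a4 d -> antider_formula a1 a4 c f b D ->
  is_biderivation (brk two n) d D.
Proof.
move=> cm /crd_der_formula[d0 d1 [d2 d3 d4 d5]].
move=> /crd_antider_formula[D0 D1 [D2 D3 D4 D5]].
rewrite /is_biderivation /is_derivation /is_antiderivation.
(* With the bracket and the maps as variables, rewriting with the coordinate
   rules never unfolds matrix operations. *)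
move: (brkE); move: (brk two n) (d : Lsp n -> Lsp n) (D : Lsp n -> Lsp n)
  d0 d1 d2 d3 d4 d5 D0 D1 D2 D3 D4 D5.
move=> br {}d {}D d0 d1 d2 d3 d4 d5 D0 D1 D2 D3 D4 D5 brE.
have E := (brE, (d0, d1, d2, d3, d4, d5), (D0, D1, D2, D3, D4, D5)).
(* Coordinate 5 is split off because the bracket there involves coordinate 4, whose rule for [d] and
   [D] is not the uniform one. *)
split=> x y; apply: (vec_ext _ _ hn) => [|||||[|j] /[dup] hj /ltnW hj'].
all: rewrite ?(E, @crdD n, @crdN n) //.
all: rewrite ?hn ?hj; try ring.
(* The relations between the constants matter along $e_2$, the only place where the two brackets
   differ. *)
all: by move: cm; rewrite /constants_match; case: two => -[cm1 cm2];
  rewrite ?cm1 ?cm2; ring.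
Qed.

Lemma crd_comb_e k a i b j : (k < n.+2)%N ->
  crd n k (a *: e n i + b *: e n j) =
    a * ((0 < i)%N && (k == i.+1))%:R + b * ((0 < j)%N && (k == j.+1))%:R.
Proof. by move=> hk; rewrite crdD !crdZ !crd_e. Qed.

(** * Derivations *)

Lemma der_formula_of_derivation (d : {linear Lsp n -> Lsp n}) :
  is_derivation (brk two n) d ->
  exists a1 a2 a3 a4, der_formula a1 a2 a3 a4 d /\ (two -> a2 = 0).
Proof.
move=> hd; have := linear0 d; move: (brkE) (prodE) hd; rewrite /is_derivation.
move: (brk two n) (d : Lsp n -> Lsp n) => br {}d brE prE hd d0.
have P k x y : crd n k (d (br x y)) = crd n k (br (d x) y) + crd n k (br x (d y)).
  by rewrite hd crdD.
have R := (prE, d0, brE).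
(* The letters [u], [v], [w], [s] stand for the images of $h_1,h_2,e_1,e_2$, and the digit is the
   coordinate. The coordinates without a lemma, [v2], [w2], [s3] and (for $\mathcal L_1$) [u3],
   become the parameters. *)
have u0 : crd n 0 (d (h1 n)) = 0.
  by have E := P 3 (e n 2) (h1 n); der R E; solve_for E (-1 : Cx).
have u1 : crd n 1 (d (h1 n)) = 0.
  by have E := P 2 (e n 1) (h1 n); der R E; solve_for E (-1 : Cx).
have u2 : crd n 2 (d (h1 n)) = 0.
  by have E := P 4 (e n 1) (h1 n); der R E; solve_for E (-1 : Cx).
have u3 : two -> crd n 3 (d (h1 n)) = 0.
  move=> t; have E := P 3 (h1 n) (h1 n); der R E; rewrite t in E.
  by solve_for E (-1 : Cx).
have u4 : crd n 4 (d (h1 n)) = 0.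
  by have E := P 4 (h1 n) (h2 n); der R E; solve_for E (- 2%:R : Cx).
have u5 j : (j.+3 < n)%N -> crd n j.+4.+1 (d (h1 n)) = 0.
  move=> /[dup] ? /ltnW ?.
  by have E := P j.+4.+1 (h1 n) (h2 n); der R E; solve_for E (- j.+3%:R : Cx).
have v0 : crd n 0 (d (h2 n)) = 0.
  by have E := P 3 (e n 2) (h2 n); der R E; solve_for E (-1 : Cx).
have v1 : crd n 1 (d (h2 n)) = 0.
  by have E := P 2 (e n 1) (h2 n); der R E; solve_for E (-1 : Cx).
have v3 : crd n 3 (d (h2 n)) = 0.
  by have E := P 3 (h2 n) (h1 n); der R E; solve_for E (-1 : Cx).
have v4 : crd n 4 (d (h2 n)) = 0.
  by have E := P 4 (h2 n) (h2 n); der R E; solve_for E (- 2%:R : Cx).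
have v5 j : (j.+3 < n)%N -> crd n j.+4.+1 (d (h2 n)) = 0.
  move=> /[dup] ? /ltnW ?.
  by have E := P j.+4.+1 (h2 n) (h2 n); der R E; solve_for E (- j.+3%:R : Cx).
have w0 : crd n 0 (d (e n 1)) = 0.
  by have E := P 0 (e n 1) (h2 n); der R E; solve_for E (1 : Cx).
have w1 : crd n 1 (d (e n 1)) = 0.
  by have E := P 1 (e n 1) (h2 n); der R E; solve_for E (1 : Cx).
have w3 : crd n 3 (d (e n 1)) = 0.
  by have E := P 3 (e n 1) (h2 n); der R E; solve_for E (1 : Cx).
have w4 : crd n 4 (d (e n 1)) = - crd n 2 (d (h2 n)).
  by have E := P 4 (e n 1) (h2 n); der R E; solve_for E (-1 : Cx).
(* Right multiplication by $h_2$ has eigenvalue $j+3$ on $e_{j+4}$ and $1$ on $e_1$; the pivot is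
   minus the difference. *)
have w5 j : (j.+3 < n)%N -> crd n j.+4.+1 (d (e n 1)) = 0.
  move=> /[dup] ? /ltnW ?.
  by have E := P j.+4.+1 (e n 1) (h2 n); der R E; solve_for E (- j.+2%:R : Cx).
have s0 : crd n 0 (d (e n 2)) = 0.
  by have E := P 0 (e n 2) (h1 n); der R E; solve_for E (1 : Cx).
have s1 : crd n 1 (d (e n 2)) = 0.
  by have E := P 1 (e n 2) (h1 n); der R E; solve_for E (1 : Cx).
have s2 : crd n 2 (d (e n 2)) = 0.
  by have E := P 2 (e n 2) (h1 n); der R E; solve_for E (1 : Cx).
have s4 : crd n 4 (d (e n 2)) = 0.
  by have E := P 4 (e n 2) (h1 n); der R E; solve_for E (1 : Cx).
have s5 j : (j.+3 < n)%N -> crd n j.+4.+1 (d (e n 2)) = 0.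
  move=> /[dup] ? /ltnW ?.
  by have E := P j.+4.+1 (e n 2) (h1 n); der R E; solve_for E (1 : Cx).
pose a1 := - crd n 2 (d (h2 n)); pose a2 := - crd n 3 (d (h1 n)).
pose a3 := crd n 3 (d (e n 2)); pose a4 := crd n 2 (d (e n 1)).
have de1 : d (e n 1) = a4 *: e n 1 + a1 *: e n 3.
  apply: (vec_ext _ _ hn) => [|||||j /[dup] ? /ltnW ?];
    rewrite ?(w0, w1, w3, w4, w5, basE) ?ltnS ?lek //= /a1 /a4; ring.
have wE k : (k < n.+2)%N ->
    crd n k (d (e n 1)) = a4 * (k == 2)%:R + a1 * (k == 4)%:R.
  by move=> hk; rewrite de1 crd_comb_e.
(* Induction along $e_3=[e_1,e_1]$ and $e_{i+1}=[e_i,e_1]$: each step shifts the index and adds one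
   $\alpha_4$ through $[e_i,d(e_1)]=\alpha_4e_{i+1}$. For [i.+3 > n] both sides are 0, since
   [k < n.+2]. *)
have deiE i k : (k < n.+2)%N ->
    crd n k (d (e n i.+3)) =
    i.+2%:R * a4 * (k == i.+4)%:R + a1 * (k == i.+4.+1)%:R.
  elim: i k => [|i IH] k hk.
    have -> : d (e n 3) = br (d (e n 1)) (e n 1) + br (e n 1) (d (e n 1)).
      by rewrite -hd prE.
    rewrite crdD; case: k hk => [|[|[|[|[|[|j]]]]]] hk;
      rewrite ?brE ?wE ?(@crd_e n); close_bound; rewrite /= ?simp0; ring.
  have -> : d (e n i.+4) = br (d (e n i.+3)) (e n 1) + br (e n i.+3) (d (e n 1)).
    by rewrite -hd prE.
  rewrite crdD; case: k hk => [|[|[|[|[|[|j]]]]]] /[dup] hk /ltnW hk';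
    rewrite ?brE ?wE ?IH ?(@crd_e n); close_bound; rewrite /= ?simp0; ring.
have dei i : d (e n i.+3) = (i.+2%:R * a4) *: e n i.+3 + a1 *: e n i.+4.
  by apply/(vec_ext _ _ hn) => [|||||j hj]; rewrite deiE ?crd_comb_e; close_bound.
exists a1, a2, a3, a4; split; last by rewrite /a2 => /u3 ->; rewrite oppr0.
split.
- apply: (vec_ext _ _ hn) => [|||||j /[dup] ? /ltnW ?];
    rewrite ?(u0, u1, u2, u4, u5, basE) ?ltnS ?lek //= /a2; ring.
- apply: (vec_ext _ _ hn) => [|||||j /[dup] ? /ltnW ?];
    rewrite ?(v0, v1, v3, v4, v5, basE) ?ltnS ?lek //= /a1; ring.
- exact: de1.
- apply: (vec_ext _ _ hn) => [|||||j /[dup] ? /ltnW ?];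
    rewrite ?(s0, s1, s2, s4, s5, basE) ?ltnS ?lek //= /a3; ring.
move=> i /andP[/subnKC <- _]; exact: dei.
Qed.

(** * Anti-derivations compatible with a given derivation *)

Lemma antider_formula_of_compatible a1 a2 a3 a4 (d D : {linear Lsp n -> Lsp n}) :
    der_formula a1 a2 a3 a4 d -> (two -> a2 = 0) ->
    is_antiderivation (brk two n) D ->
    (forall x y, brk two n x (d y) = brk two n x (D y)) ->
  exists c f b, constants_match a2 a3 c f /\ antider_formula a1 a4 c f b D.
Proof.
move=> /crd_der_formula[d0 d1 [d2 d3 _ _]] a2_0 hD hc.
have := linear0 D; move: (brkE) (prodE) (@brk_h1e2 two n hn) hD hc.
rewrite /is_antiderivation.
move: (brk two n) (D : Lsp n -> Lsp n) (d : Lsp n -> Lsp n) d0 d1 d2 d3.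
move=> br {}D {}d d0 d1 d2 d3 brE prE h1e2 hD hc D_0.
have P k x y :
    crd n k (D (br x y)) = crd n k (br (D x) y) - crd n k (br (D y) x).
  by rewrite hD crdD crdN.
have C k x y := congr1 (crd n k) (hc x y).
have R := (prE, D_0, brE).
(* Left multiplication by $e_2$ detects the $h_1$ coordinate, by $e_1$ those of $h_2$ and $e_1$, and
   by $h_1$, in $\mathcal L_1$ only, that of $e_2$. On these coordinates compatibility forces [D] to
   agree with [d]. *)
have D0 y : crd n 0 (D y) = 0.
  by rewrite -(d0 y); have E := C 3 (e n 2) y; der R E; solve_for E (-1 : Cx).
have D1 y : crd n 1 (D y) = 0.
  by rewrite -(d1 y); have E := C 2 (e n 1) y; der R E; solve_for E (-1 : Cx).
have D2 y : crd n 2 (D y) = a4 * crd n 2 y - a1 * crd n 1 y.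
  by rewrite -d2; have E := C 4 (e n 1) y; der R E; solve_for E (-1 : Cx).
have D3 y : ~~ two -> crd n 3 (D y) = a3 * crd n 3 y - a2 * crd n 0 y.
  move=> /negPf t; rewrite -d3; have E := C 3 (h1 n) y; der R E.
  by rewrite t in E; solve_for E (1 : Cx).
have {}R := (prE, D_0, brE, D0, D1, D2).
(* From here [p], [q], [r], [s] stand for the images of $h_1,h_2,e_1,e_2$ under [D]. *)
have p4 : crd n 4 (D (h1 n)) = 0.
  by have E := P 4 (h1 n) (h2 n); der R E; solve_for E (- 2%:R : Cx).
have p5 j : (j.+3 < n)%N -> crd n j.+4.+1 (D (h1 n)) = 0.
  move=> /[dup] ? /ltnW ?.
  by have E := P j.+4.+1 (h1 n) (h2 n); der R E; solve_for E (- j.+3%:R : Cx).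
have q3 : crd n 3 (D (h2 n)) = 0.
  by have E := P 3 (h2 n) (h1 n); der R E; solve_for E (-1 : Cx).
have r3 : crd n 3 (D (e n 1)) = 0.
  by have E := P 3 (e n 1) (h2 n); der R E; solve_for E (1 : Cx).
have r4 : crd n 4 (D (e n 1)) = - a1.
  by have E := P 4 (e n 1) (h2 n); der R E; solve_for E (-1 : Cx).
(* The $e_{i+1}$ coordinate of $D([e_1,h_2])=D(e_1)$ contains the $e_i$ coordinate of $D(h_2)$,
   because $[e_i,e_1]=e_{i+1}$. For $i=n$ there is no such equation, which leaves $\beta_{n+1}$
   free. *)
have q4 : (3 < n)%N -> crd n 4 (D (h2 n)) = 2%:R * crd n 5 (D (e n 1)).
  move=> ?; have E := P 5 (e n 1) (h2 n); der R E; solve_for E (1 : Cx).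
have q5 j : (j.+4 < n)%N ->
    crd n j.+4.+1 (D (h2 n)) = j.+3%:R * crd n j.+4.+2 (D (e n 1)).
  move=> /[dup] ? /ltnW ?.
  by have E := P j.+4.+2 (e n 1) (h2 n); der R E; solve_for E (1 : Cx).
have s4 : crd n 4 (D (e n 2)) = 0.
  by have E := P 4 (e n 2) (h2 n); der R E; solve_for E (- 2%:R : Cx).
have s5 j : (j.+3 < n)%N -> crd n j.+4.+1 (D (e n 2)) = 0.
  move=> /[dup] ? /ltnW ?.
  by have E := P j.+4.+1 (e n 2) (h2 n); der R E; solve_for E (- j.+3%:R : Cx).
have s3 : two -> crd n 3 (D (e n 2)) = 0.
  move=> t; have E := P 3 (h1 n) (e n 2); rewrite h1e2 t in E; der R E.
  by solve_for E (1 : Cx).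
(* $D([e_1,e_1])=[D(e_1),e_1]-[D(e_1),e_1]=0$ starts the induction; it continues because right
   multiplication by $e_i$, $i\ge3$, is zero. *)
have Dei i k : (k < n.+2)%N -> crd n k (D (e n i.+3)) = 0.
  elim: i k => [|i IH] k hk; first by rewrite -prE P subrr.
  rewrite -prE P; case: k hk => [|[|[|[|[|[|j]]]]]] /[dup] hk /ltnW hk';
    rewrite ?brE ?IH ?(@crd_e n); close_bound; rewrite /= ?simp0; ring.
(* $\beta_i$ is read from $D(e_1)$ for $i\le n$, while $\beta_{n+1}$ is the $e_n$ coordinate of
   $D(h_2)$, at index [n.+1]. *)
pose b i := if (i <= n)%N then crd n i.+1 (D (e n 1)) else crd n n.+1 (D (h2 n)).
exists (crd n 3 (D (h1 n))), (crd n 3 (D (e n 2))), b.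
have bS i : (i < n)%N -> b i.+1 = crd n i.+2 (D (e n 1)).
  by move=> hi; rewrite /b hi.
(* The boundary case $e_k=e_n$, packaged as a pair of rewrite rules. *)
have bl k : (k <= n)%N -> (k < n)%N = false ->
    (k == n = true) * (b n.+1 = crd n k.+1 (D (h2 n))).
  move=> k_le /negbT k_ge; have kn : k = n.
    by apply/eqP; rewrite eqn_leq k_le leqNgt.
  split; first exact/eqP; rewrite /b ltnn; congr (crd n _.+1 _); exact: esym.
have sE := (@crd0_sum_e n, @crd_sum_e n).
split.
  rewrite /constants_match; move: s3 a2_0 D3.
  case: (two) => [s3 a20 _ | _ _ D3]; first by rewrite a20 ?s3.
  by rewrite !D3 // ?(@crd_h1 n) ?(@crd_e n) ?ltnS ?lek //=; split; ring.
split; first 4 last.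
- move=> i /andP[/subnKC <- _].
  apply: (vec_ext _ _ hn) => [|||||j hj]; rewrite Dei ?crd0 //; close_bound.
- apply: (vec_ext _ _ hn) => [|||||j /[dup] ? /ltnW ?];
    rewrite ?(D0, D1, D2, p4, p5, basE) ?ltnS ?lek //=; ring.
- have n0 : 0 == n = false by rewrite ltn_eqF ?lek.
  have n1 : 1 == n = false by rewrite ltn_eqF ?lek.
  have n2 : 2 == n = false by rewrite ltn_eqF ?lek.
  apply: (vec_ext _ _ hn) => [|||||j /[dup] hj /ltnW ?];
    rewrite ?(D0, D1, D2, q3, basE, sE) ?ltnS ?lek //= ?hj ?eqSS ?n0 ?n1 ?n2
            ?andbF /=; try ring.
    case h: (3 < n)%N; last by rewrite !(bl 3) //=; ring.
    by rewrite (ltn_eqF h) q4 // bS //=; ring.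
  case h: (j.+4 < n)%N; last by rewrite !(bl j.+4) //=; ring.
  by rewrite (ltn_eqF h) q5 // bS //=; ring.
- apply: (vec_ext _ _ hn) => [|||||j /[dup] hj /ltnW ?];
    rewrite ?(D0, D1, D2, r3, r4, bS, basE, sE) ?ltnS ?lek //=; try ring.
  by rewrite hj; ring.
- apply: (vec_ext _ _ hn) => [|||||j /[dup] ? /ltnW ?];
    rewrite ?(D0, D1, D2, s4, s5, basE) ?ltnS ?lek //=; ring.
Qed.

End Biderivations.

(** * The characterization for both algebras, and its two specializations *)

Lemma biderivationP (two : bool) (n : nat) (hn : (3 <= n)%N)
    (d D : {linear Lsp n -> Lsp n}) :
  is_biderivation (brk two n) d D <->
  exists a1 a2 a3 a4 c f b, constants_match (two := two) a2 a3 c f /\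
    der_formula a1 a2 a3 a4 d /\ antider_formula a1 a4 c f b D.
Proof.
split=> [[hd hD hc] | [a1 [a2 [a3 [a4 [c [f [b [cm [hd hD]]]]]]]]]]; last first.
  exact: (biderivation_of_formulas hn _ _ _ _ _ _ _ _ _ cm hd hD).
have [a1 [a2 [a3 [a4 [fd a2_0]]]]] := der_formula_of_derivation hn d hd.
have [c [f [b [cm fD]]]] := antider_formula_of_compatible hn _ _ _ _ _ _ fd a2_0 hD hc.
by exists a1, a2, a3, a4, c, f, b.
Qed.

Transparent Cx.

Theorem mainTheorem13 (n : nat) (hn : (4 <= n)%N) :
  (forall d D : {linear Lsp n -> Lsp n},
     is_biderivation (L1br n) d D <->
     exists (a1 a2 a3 a4 : Cx) (b : nat -> Cx),
       [/\ d (h1 n) = - (a2 *: e n 2),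
           d (h2 n) = - (a1 *: e n 1),
           d (e n 1) = a4 *: e n 1 + a1 *: e n 3,
           d (e n 2) = a3 *: e n 2 &
           (forall i, (3 <= i <= n)%N ->
              d (e n i) = ((i.-1)%:R * a4) *: e n i + a1 *: e n i.+1)] /\
       [/\
           D (h1 n) = - (a2 *: e n 2),
           D (h2 n) = - (a1 *: e n 1)
                      + \sum_(3 <= i < n) ((i.-1)%:R * b i.+1) *: e n i
                      + b n.+1 *: e n n,
           D (e n 1) = a4 *: e n 1 - a1 *: e n 3
                       + \sum_(4 <= i < n.+1) b i *: e n i,
           D (e n 2) = a3 *: e n 2 &
           (forall i, (3 <= i <= n)%N -> D (e n i) = 0)])
  /\
  (forall d D : {linear Lsp n -> Lsp n},
     is_biderivation (L2br n) d D <->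
     exists (a1 a2 a3 : Cx) (b : nat -> Cx),
       [/\ d (h1 n) = 0,
           d (h2 n) = - (a1 *: e n 1),
           d (e n 1) = a3 *: e n 1 + a1 *: e n 3,
           d (e n 2) = a2 *: e n 2 &
           (forall i, (3 <= i <= n)%N ->
              d (e n i) = ((i.-1)%:R * a3) *: e n i + a1 *: e n i.+1)] /\
       [/\
           D (h1 n) = b n.+2 *: e n 2,
           D (h2 n) = - (a1 *: e n 1)
                      + \sum_(3 <= i < n) ((i.-1)%:R * b i.+1) *: e n i
                      + b n.+1 *: e n n,
           D (e n 1) = a3 *: e n 1 - a1 *: e n 3
                       + \sum_(4 <= i < n.+1) b i *: e n i &
           (forall i, (2 <= i <= n)%N -> D (e n i) = 0)]).
Proof.
have hn3 : (3 <= n)%N by apply: ltnW.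
split=> d D; split.
- move=> /(@biderivationP false n hn3)[a1 [a2 [a3 [a4 [c [f [b [[-> ->]]]]]]]]].
  move=> [[d1 d2 d3 d4 d5] [D1 D2 D3 D4 D5]].
  by exists a1, a2, a3, a4, b; rewrite -!scaleNr.
- move=> [a1 [a2 [a3 [a4 [b]]]]]; rewrite -!scaleNr => -[fd fD].
  by apply/(@biderivationP false n hn3); exists a1, a2, a3, a4, (- a2), a3, b.
- move=> /(@biderivationP true n hn3)[a1 [a2 [a3 [a4 [c [f [b [[-> ->]]]]]]]]].
  move=> [[d1 d2 d3 d4 d5] [D1 D2 D3 D4 D5]].
  (* With $\alpha_2=0$ in the common formulas, their $\alpha_3,\alpha_4$ are renamed
     $\alpha_2,\alpha_3$. The constant [c] becomes $\beta_{n+2}$, stored at an index that the sums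
     and the term $\beta_{n+1}e_n$ never reach. *)
  exists a1, a3, a4, (fun i => if i == n.+2 then c else b i).
  rewrite -!scaleNr; split; split=> //.
  + by rewrite d1 oppr0 scale0r.
  + by rewrite eqxx.
  + rewrite D2 (ltn_eqF (ltnSn _)); congr (_ + _ + _); apply: eq_big_nat => i /andP[_ hi].
    by rewrite ltn_eqF // !ltnS ltnW.
  + rewrite D3; congr (_ + _); apply: eq_big_nat => i /andP[_ hi].
    by rewrite ltn_eqF // ltnW.
  (* The case $i=2$ comes from [f = 0]. *)
  + move=> i /andP[]; rewrite leq_eqVlt => /orP[/eqP <- _|i3 hi].
      by rewrite D4 scale0r.
    by apply: D5; rewrite i3.
- move=> [a1 [a3 [a4 [b]]]]; rewrite -!scaleNr.
  move=> [[d1 d2 d3 d4 d5] [D1 D2 D3 D4]].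
  apply/(@biderivationP true n hn3).
  exists a1, 0, a3, a4, (b n.+2), 0, b; split=> //; split; split=> //.
  + by rewrite d1 oppr0 scale0r.
  + by rewrite scale0r D4 //= ltnW // ltnW.
  + by move=> i /andP[i3 hi]; rewrite D4 // hi ltnW.
Qed.
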